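(* Let $I(n)=\{0,1,\dots,n\}$ and let $\{(A(i),B(i))\}_{i\in I(n)}$ be a family of aspherical pairs, with each $B(i)$ a nonempty closed subspace of $A(i)$. Let $X=A(0)\times\cdots\times A(n)$ with the corner structure $\mathcal M=\{X_i\}_{i\in I(n)}$ given by $X_i=\{\mathbf x\in X\mid x_i\in B(i)\}$. Then: (i)$'$ $X$ is aspherical; (ii)$'$ the induced mirror structure $\widetilde{\mathcal M}$ on the universal cover $\widetilde X$ of $X$ is acyclic; (iii)$'$ $\widetilde{\mathcal M}$ is flag.
   Context: A pair of spaces $(A,B)$ is an aspherical pair if $A$ is path connected and aspherical, each path component of $B$ is aspherical, and the fundamental group of each path component of $B$ maps injectively into $\pi_1(A)$. (A path connected space is aspherical if its universal cover is contractible.) A mirror structure on a space $X$ over a set $I$ is a family $\{X_i\}_{i\in I}$ of closed subspaces (mirrors); put $X_J=\bigcap_{i\in J}X_i$, $X_\emptyset=X$. It is a corner structure over $I(n)$ if $I=I(n)$, $X$ is path connected and $X_J\ne\emptyset$ for all $J\subseteq I(n)$. The nerve of a mirror structure is the simplicial complex with vertex set $I$ in which a (finite nonempty) subset $J$ spans a simplex iff $X_J\neq\emptyset$; the mirror structure is flag if its nerve is a flag complex, i.e. any set of vertices that are pairwise joined by edges spans a simplex. The mirror structure is acyclic if $X$ is acyclic (all reduced homology vanishes) and each nonempty intersection of mirrors is acyclic. Induced mirror structure: let $p:\widetilde X\to X$ be the universal covering, $E_i$ the set of path components of $p^{-1}(X_i)$, $E=\coprod_iE_i$; then $\widetilde{\mathcal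 M}=\{\widetilde X_e\}_{e\in E}$ with $\widetilde X_e:=e$. *)

(* Defs.v *)
From HB Require Import structures.
From mathcomp Require Import all_boot all_order all_algebra.
From mathcomp Require Import all_classical all_reals topology homotopy.
From mathcomp Require Import freeg.

Set Implicit Arguments.
Unset Strict Implicit.
Unset Printing Implicit Defensive.

Import Order.TTheory GRing.Theory Num.Theory.
Import numFieldTopology.Exports.

Local Open Scope classical_set_scope.
Local Open Scope ring_scope.

(* The topology of a subset [A : set T] is the one carried by the type         *)
(* [set_type A], into which sets coerce.                                       *)

Definition unit_interval (R : realType) : Type := `[0, 1]%classic : set R.

Section UnitInterval.
Variable R : realType.

HB.instance Definition _ :=
  Topological.copy (unit_interval R) (set_type (`[0, 1]%classic : set R)).

Let mem0 : (0 : R) \in (`[0, 1]%classic : set R).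
Proof. by rewrite inE /= in_itv /= lexx ler01. Qed.

Let mem1 : (1 : R) \in (`[0, 1]%classic : set R).
Proof. by rewrite inE /= in_itv /= ler01 lexx. Qed.

Let neq01 : (exist _ 0 mem0 : unit_interval R) != exist _ 1 mem1.
Proof.
by apply/eqP => /(congr1 (@sval _ _))/eqP; rewrite /= eq_sym oner_eq0.
Qed.

HB.instance Definition _ := isBiPointed.Build (unit_interval R) neq01.
End UnitInterval.

Section Homotopy.
Variable R : realType.
Local Notation I := (unit_interval R).

(* [f] and [g] are homotopic relative to their endpoints. *)
Definition path_homotopic (T : topologicalType) (f g : I -> T) :=
  exists H : I * I -> T, [/\ continuous H,
    forall s, H (s, zero) = f s,
    forall s, H (s, one) = g s,
    forall t, H (zero, t) = f zero
    & forall t, H (one, t) = f one].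

Definition path_component (T : topologicalType) (S : set T) (x : T) : set T :=
  [set y | exists f : {path I from x to y in T}, range f `<=` S].

Definition path_components (T : topologicalType) (S : set T) : set (set T) :=
  path_component S @` S.

Definition path_connected (T : topologicalType) :=
  [set: T] !=set0 /\ forall x y : T, inhabited {path I from x to y in T}.

Definition simply_connected (T : topologicalType) :=
  path_connected T /\
  forall (x : T) (f g : {path I from x to x in T}), path_homotopic f g.

Definition contractible (T : topologicalType) :=
  exists (c : T) (H : T * I -> T), [/\ continuous H,
    forall x, H (x, zero) = x & forall x, H (x, one) = c].

(* Injectivity of the map induced by [h] on fundamental groups, for every      *)
(* base point; homotopy classes are given by representatives.                  *)
Definition pi1_injective (S T : topologicalType) (h : S -> T) :=
  forall (x : S) (f g : {path I from x to x in S}),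
    path_homotopic (h \o f) (h \o g) -> path_homotopic f g.
End Homotopy.

Section Covering.
Variables E X : topologicalType.

Definition restricts_to_homeo (p : E -> X) (V : set E) (U : set X) :=
  {within V, continuous p} /\
  exists s : X -> E, [/\ {within U, continuous s},
    set_fun V U p, set_fun U V s, {in V, cancel p s} & {in U, cancel s p}].

Definition evenly_covered (p : E -> X) (U : set X) :=
  exists S : set (set E), [/\ p @^-1` U = \bigcup_(V in S) V,
    trivIset S id
    & forall V, S V -> open V /\ restricts_to_homeo p V U].

Definition covering (p : E -> X) :=
  [/\ continuous p, range p = [set: X]
    & forall x, exists U, [/\ open U, U x & evenly_covered p U]].
End Covering.

Definition universal_covering (R : realType) (E X : topologicalType)
    (p : E -> X) :=
  covering p /\ simply_connected R E.

(* No local connectedness is assumed, so having a universal cover is part of   *)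
(* the property.  A covering of a contractible space is trivial, hence once    *)
(* one universal cover is contractible every other one is homeomorphic to it   *)
(* over [X].                                                                   *)
Definition aspherical (R : realType) (X : topologicalType) :=
  path_connected R X /\
  exists (E : topologicalType) (p : E -> X),
    universal_covering R p /\ contractible R E.

Definition aspherical_pair (R : realType) (A : topologicalType) (B : set A) :=
  aspherical R A /\
  forall C : set A, path_components R B C ->
    aspherical R C /\ pi1_injective R (set_val : C -> A).

(* Singular homology with integer coefficients. *)
Section SingularHomology.
Variable R : realType.

Definition std_simplex (k : nat) : set 'rV[R]_k.+1 :=
  [set t | (forall i, 0 <= t 0 i) /\ \sum_i t 0 i = 1].

Arguments std_simplex : clear implicits.

Definition coface_mx (k : nat) (i : 'I_k.+2) (t : 'rV[R]_k.+1) : 'rV[R]_k.+2 :=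
  \row_j (if unlift i j is Some j' then t 0 j' else 0).

Lemma coface_mx_simplex (k : nat) (i : 'I_k.+2) (t : std_simplex k) :
  coface_mx i (set_val t) \in std_simplex k.+1.
Proof.
have [t0 t1] : std_simplex k (set_val t) by apply: set_mem; exact: valP t.
rewrite inE; split=> [j|]; first by rewrite mxE; case: unlift.
rewrite (bigD1_ord i) //= mxE unlift_none add0r -[RHS]t1.
by apply: eq_bigr => j _; rewrite mxE liftK.
Qed.

Definition coface (k : nat) (i : 'I_k.+2) (t : std_simplex k) :
  std_simplex k.+1 :=
  exist _ (coface_mx i (set_val t)) (coface_mx_simplex i t).

Lemma coface_mx_continuous (k : nat) (i : 'I_k.+2) :
  continuous (@coface_mx k i).
Proof.
move=> t U /= [P tP PU]; exists (fun=> fun j => P 0 (fintype.lift i j)).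
  by move=> a j; have := tP 0 (fintype.lift i j); rewrite mxE liftK ord1.
move=> s sP; apply: PU => a j; rewrite ord1 mxE.
case: unliftP => [j' ->|jE]; first exact: sP 0 j'.
by apply: nbhs_singleton; have := tP 0 j; rewrite mxE jE unlift_none.
Qed.

Lemma coface_continuous (k : nat) (i : 'I_k.+2) : continuous (@coface k i).
Proof.
apply: continuous_comp_initial => t.
apply: (@continuous_comp _ _ _ set_val (coface_mx i)).
  exact: initial_continuous.
exact: coface_mx_continuous.
Qed.

HB.instance Definition _ (k : nat) (i : 'I_k.+2) :=
  isContinuous.Build _ _ (@coface k i) (@coface_continuous k i).

Variable T : topologicalType.

Definition singular_simplex (k : nat) := continuousType (std_simplex k) T.

Definition singular_face (k : nat) (i : 'I_k.+2) (s : singular_simplex k.+1) :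
  singular_simplex k := s \o coface i.

Definition singular_chain (k : nat) := {freeg (singular_simplex k) / int}.

Definition boundary (k : nat) : singular_chain k.+1 -> singular_chain k :=
  fglift (fun s => \sum_(i < k.+2) (-1) ^+ i *: << singular_face i s >>).

(* Exactness of the augmented singular complex, where [deg] is the             *)
(* augmentation; in degree -1 this says that [T] is not empty.                 *)
Definition acyclic :=
  [/\ exists c : singular_chain 0, deg c = 1,
      forall c : singular_chain 0, deg c = 0 ->
        exists d : singular_chain 1, boundary d = c
    & forall (k : nat) (c : singular_chain k.+1), boundary c = 0 ->
        exists d : singular_chain k.+2, boundary d = c].
End SingularHomology.

Section Mirrors.
Variables (X : topologicalType) (I : Type).
Implicit Types (M : I -> set X) (J : set I).

Definition mirror_inter M J : set X := \bigcap_(i in J) M i.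

Definition nerve M : set (set I) :=
  [set J | [/\ finite_set J, J !=set0 & mirror_inter M J !=set0]].

(* Every element of [I] counts as a vertex, so a flag nerve has no empty       *)
(* mirror; [J] may be infinite, in which case it spans no simplex.             *)
Definition flag_complex (K : set (set I)) :=
  forall J, J !=set0 ->
    (forall i j, J i -> J j -> i <> j -> K [set i; j]) -> K J.

Definition mirror_flag M := flag_complex (nerve M).

Definition mirror_acyclic (R : realType) M :=
  acyclic R X /\
  forall J, mirror_inter M J !=set0 -> acyclic R (mirror_inter M J).

Definition corner_structure (R : realType) M :=
  [/\ forall i, closed (M i), path_connected R X
    & forall J, mirror_inter M J !=set0].

(* The index set is the disjoint union over [i : I] of the sets of path        *)
(* components of the preimages of the mirrors.                                 *)
Definition induced_index (R : realType) (Xt : topologicalType) (p : Xt -> X) M :=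
  {i : I & path_components R (p @^-1` M i)}.

Definition induced_mirror (R : realType) (Xt : topologicalType) (p : Xt -> X) M
  (e : induced_index R p M) : set Xt := set_val (projT2 e).
End Mirrors.

Definition corner_mirror (I : Type) (A : I -> topologicalType)
    (B : forall i, set (A i)) (i : I) : set (prod_topology A) :=
  [set x | B i (x i)].

Lemma prod_topology_continuous (I : eqType) (A : I -> topologicalType)
    (U : topologicalType) (g : U -> prod_topology A) :
  (forall i, continuous (fun u => g u i)) -> continuous g.
Proof.
move=> gc u; have FF : Filter (g @ u) := fmap_filter _ (nbhs_filter u).
apply: (iffRL (@cvg_sup _ _ _ (g @ u) (g u) FF)) => i W.
rewrite nbhsE => -[V [[V' oV' <-] V'gu] VW].
apply: filterS VW _; apply: (gc i u).
exact: open_nbhs_nbhs.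
Qed.

Lemma corner_mirror_structure (R : realType) (I : eqType)
    (A : I -> topologicalType) (B : forall i, set (A i)) :
  (forall i, path_connected R (A i)) -> (forall i, closed (B i)) ->
  (forall i, B i !=set0) -> corner_structure R (corner_mirror B).
Proof.
move=> Apc Bcl Bn0; pose b i := sval (cid (Bn0 i)).
have Bb i : B i (b i) by rewrite /b; case: cid.
split=> [i||J]; last by exists b => i _; exact: Bb.
  by apply: (preimage_closed _ (Bcl i)) => x _; exact: proj_continuous.
split=> [|x y]; first by exists b.
have f i : {path unit_interval R from x i to y i in A i}.
  exact: inhabited_witness ((Apc i).2 _ _).
pose g (t : unit_interval R) : prod_topology A := fun i => f i t.
have g_cont : continuous g.
  by apply: prod_topology_continuous => i; exact: cts_fun.
have g0 : g zero = x.
  by apply: functional_extensionality_dep => i; exact: path_zero.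
have g1 : g one = y.
  by apply: functional_extensionality_dep => i; exact: path_one.
by split; exact: (mk_path g_cont g0 g1 : {path _ from x to y}).
Qed.

(* Main.v *)
Require Import Defs.
From HB Require Import structures.
From mathcomp Require Import all_boot all_order all_algebra.
From mathcomp Require Import all_classical all_reals topology homotopy.
From mathcomp Require Import normedtype freeg lra.

(* Coverings lift homotopies, uniquely along paths; since everything is tested on
   the connected interval, no local hypothesis on the spaces is needed.

   Let E_i be a contractible universal cover of A_i.  The product of the E_i is a
   contractible universal cover of X, and lifting its contraction gives a
   continuous bijection s from it onto any other universal cover Xt of X, through
   which all maps from contractible spaces to Xt factor.  Under s, the mirrors
   over i become the products of the E_j, j <> i, with a path component of the
   preimage of B_i in E_i.  Flagness follows: distinct mirrors with the same i are
   disjoint, and mirrors with distinct i always intersect.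

   For a path component D of B_i, the contractible universal cover of D lifts to
   E_i.  By injectivity on fundamental groups the lift is injective; its image is a
   path component C of the preimage of B_i, and maps from contractible spaces to C
   factor through it.  Hence every intersection of mirrors receives a continuous
   injection from a contractible space F through which all singular simplices
   factor, and the cone operator of F transports to its singular complex. *)

Set Implicit Arguments.
Unset Strict Implicit.
Unset Printing Implicit Defensive.

Import Order.TTheory GRing.Theory Num.Theory.
Import numFieldTopology.Exports numFieldNormedType.Exports.

Local Open Scope classical_set_scope.
Local Open Scope ring_scope.

(** * The unit interval *)

Section UnitInterval.
Variable R : realType.
Local Notation I := (unit_interval R).

Definition ival (t : I) : R := @set_val R `[0, 1]%classic t.

Lemma ival_continuous : continuous ival.
Proof. exact: initial_continuous. Qed.

Lemma clamp_proof (x : R) : Num.max 0 (Num.min x 1) \in (`[0, 1]%classic : set R).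
Proof. by rewrite inE /= in_itv /= le_max lexx /= ge_max ler01 ge_min lexx orbT. Qed.

(** A retraction of the real line onto the interval: maps into [I] can then be given by real
    formulas and their continuity checked in [R]. *)
Definition clamp (x : R) : I := exist _ (Num.max 0 (Num.min x 1)) (clamp_proof x).

Lemma ival_ge0 (t : I) : 0 <= ival t.
Proof. by have := set_valP t; rewrite /= in_itv /= => /andP[]. Qed.

Lemma ival_le1 (t : I) : ival t <= 1.
Proof. by have := set_valP t; rewrite /= in_itv /= => /andP[]. Qed.

Lemma clampK (x : R) : 0 <= x <= 1 -> ival (clamp x) = x.
Proof. by case/andP => x0 x1; rewrite /ival set_valE /= min_l// max_r. Qed.

Lemma ivalK (t : I) : clamp (ival t) = t.
Proof.
by apply: val_inj; apply: clampK; rewrite ival_ge0 ival_le1.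
Qed.

Lemma ival0 : ival zero = 0. Proof. by []. Qed.
Lemma ival1 : ival one = 1. Proof. by []. Qed.

Lemma clamp0 (x : R) : x <= 0 -> clamp x = zero.
Proof.
by move=> x0; apply: val_inj; rewrite /= min_l ?max_l// (le_trans x0 ler01).
Qed.

Lemma clamp1 (x : R) : 1 <= x -> clamp x = one.
Proof. by move=> x1; apply: val_inj; rewrite /= min_r// max_r. Qed.

Lemma clamp_continuous : continuous clamp.
Proof.
apply: continuous_comp_initial => x /=.
apply: (@continuous_max R R (cst 0) (id \min cst 1) x); first exact: cvg_cst.
by apply: (@continuous_min R R id (cst 1) x); [exact: cvg_id|exact: cvg_cst].
Qed.

Lemma nbhs_ivalP (t : I) (W : set I) : nbhs t W <->
  exists2 e : R, 0 < e & forall u, `|ival t - ival u| < e -> W u.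
Proof.
split=> [tW|[e e0 eW]].
  have : nbhs (ival t) (clamp @^-1` W).
    by apply: clamp_continuous; rewrite ivalK.
  move=> /nbhs_ballP[e /= e0 eW]; exists e => // u tu.
  by rewrite -(ivalK u); apply: eW.
have : nbhs (ival t) (ball (ival t) e) by exact: (nbhsx_ballx _ _ e0).
move=> /(@ival_continuous t); apply: (@filterS _ (nbhs t) _ (ival @^-1` ball (ival t) e)).
by move=> u; exact: eW.
Qed.

Lemma ball_unit_interval_connected (t : I) (e : R) :
  connected [set u : I | `|ival t - ival u| < e].
Proof.
have -> : [set u : I | `|ival t - ival u| < e] =
    clamp @` [set x : R | 0 <= x <= 1 /\ `|ival t - x| < e].
  apply/seteqP; split=> [u /= tu|_ /= [x [x01 tx] <-]]; last by rewrite clampK.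
  by exists (ival u); [rewrite ival_ge0 ival_le1|rewrite ivalK].
apply: connected_continuous_connected; last first.
  by apply: continuous_subspaceT => x; exact: clamp_continuous.
apply/connected_intervalP => x y [/andP[x0 x1] tx] [/andP[y0 y1] ty] z /andP[xz zy].
split; first by rewrite (le_trans x0 xz) (le_trans zy y1).
move: tx ty; rewrite !ltr_distlC => /andP[tx _] /andP[_ ty].
by rewrite (lt_le_trans tx xz) (le_lt_trans zy ty).
Qed.

(** Connectedness of the interval in the form of an induction principle. Since [u] and [v] are both
    arbitrary near [t], truth and falsity of [P] spread alike, so [P] is open and closed. *)
Lemma unit_interval_ind (P : I -> Prop) :
  (forall t : I, exists2 W, nbhs t W & forall u v, W u -> W v -> P u -> P v) ->
  forall s t, P s -> P t.
Proof.
move=> Pn s t Ps; suff -> : P = setT by [].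
have conn : connected [set: I].
  have -> : [set: I] = [set u : I | `|ival (zero : I) - ival u| < 2].
    apply/seteqP; split=> // u _ /=.
    by rewrite ival0 sub0r normrN ger0_norm ?ival_ge0// (le_lt_trans (ival_le1 u))// ltr1n.
  exact: ball_unit_interval_connected.
apply: conn; first by exists s.
- exists P; last by rewrite setTI.
  rewrite openE => u Pu; have [W uW WP] := Pn u.
  by apply: filterS (uW) => v Wv; exact: WP (nbhs_singleton uW) Wv Pu.
- exists P; last by rewrite setTI.
  rewrite -openC openE => u Pu; have [W uW WP] := Pn u.
  by apply: filterS (uW) => v Wv Pv; apply: Pu; exact: WP Wv (nbhs_singleton uW) Pv.
Qed.

Lemma paste_continuous (T : topologicalType) (f g : I -> T) (a : I) :
  continuous f -> continuous g -> f a = g a ->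
  continuous (fun u => if ival u <= ival a then f u else g u).
Proof.
move=> cf cg fg; pose h u := if ival u <= ival a then f u else g u.
have cl1 : closed [set u : I | ival u <= ival a].
  apply: (@preimage_closed _ _ ival [set x | x <= ival a]); last exact: closed_le.
  by move=> x _; exact: ival_continuous.
have cl2 : closed [set u : I | ival a <= ival u].
  apply: (@preimage_closed _ _ ival [set x | ival a <= x]); last exact: closed_ge.
  by move=> x _; exact: ival_continuous.
have := @withinU_continuous _ _ _ _ h cl1 cl2.
have -> : [set u : I | ival u <= ival a] `|` [set u : I | ival a <= ival u] = setT.
  by apply/seteqP; split => // u _ /=; apply/orP; exact: le_total.
move=> hc; apply/continuous_subspace_setT; apply: hc.
- apply: (@subspace_eq_continuous _ _ _ f); last exact: continuous_subspaceT.
  by move=> u /set_mem /= ua; rewrite /from_subspace /h ua.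
- apply: (@subspace_eq_continuous _ _ _ g); last exact: continuous_subspaceT.
  move=> u /set_mem /= au; rewrite /from_subspace /h; case: ifPn => // ua.
  suff -> : u = a by rewrite fg.
  by apply: (can_inj ivalK); apply/eqP; rewrite eq_le ua au.
Qed.

End UnitInterval.

(** * Lifting along coverings *)

Lemma continuous_pair (T U V : topologicalType) (f : T -> U) (g : T -> V) :
  continuous f -> continuous g -> continuous (fun x => (f x, g x)).
Proof. by move=> cf cg x; apply: cvg_pair; [exact: cf|exact: cg]. Qed.

Lemma continuous_compose (T U V : topologicalType) (f : T -> U) (g : U -> V) :
  continuous f -> continuous g -> continuous (fun x => g (f x)).
Proof.
by move=> cf cg x; apply: (@continuous_comp _ _ _ f g); [exact: cf|exact: cg].
Qed.

Lemma continuous_idfun (T : topologicalType) : continuous (fun x : T => x).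
Proof. by move=> x; exact: cvg_id. Qed.

Section Lifting.
Variables (R : realType) (E X : topologicalType) (p : E -> X).
Hypothesis cov_p : covering p.
Local Notation I := (unit_interval R).

(** The second clause makes [V] relatively closed in the preimage of [U]. Continuity of [s] is
    stated at points of [U] in the whole of [X], which for open [U] is continuity within [U]. *)
Definition is_sheet (U : set X) (V : set E) (s : X -> E) :=
  [/\ open V, open (p @^-1` U `\` V), forall u, U u -> {for u, continuous s},
      forall u, U u -> V (s u) /\ p (s u) = u & forall v, V v -> s (p v) = v].

Lemma covering_sheet (x : X) : exists U, [/\ open U, U x &
  forall e, U (p e) -> exists V s, V e /\ is_sheet U V s].
Proof.
have [cp _ /(_ x)[U [oU Ux [S [SU tS Ssheet]]]]] := cov_p.
exists U; split=> // e Ue.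
have [V SV Ve] : (\bigcup_(V in S) V) e by rewrite -SU.
have [oV [_ [s [cs pVU sUV sK Ks]]]] := Ssheet _ SV.
exists V, s; split=> //; split=> //.
(* By disjointness the complement of [V] over [U] is the union of the other sheets, hence open. *)
- rewrite SU; have -> : \bigcup_(W in S) W `\` V = \bigcup_(W in S `\` [set V]) W.
    apply/seteqP; split=> [y [[W SW Wy] nVy]|y [W [SW /= nWV] Wy]].
      by exists W => //; split=> // WV; apply: nVy; rewrite -WV.
    split; first by exists W.
    by move=> Vy; apply: nWV; apply: tS => //; exists y.
  by apply: bigcup_open => W [SW _]; have [] := Ssheet _ SW.
- by move: cs; rewrite continuous_open_subspace// => cs u Uu; apply: cs; rewrite inE.
- by move=> u Uu; split; [exact: sUV|apply: Ks; rewrite inE].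
- by move=> v Vv; apply: sK; rewrite inE.
Qed.

(** A sheet is clopen in the preimage of [U], so a connected set lying over [U] cannot leave it. *)
Lemma sheet_connected (U : set X) (V : set E) (s : X -> E) (Z : topologicalType)
    (g : Z -> E) (S : set Z) (z0 : Z) : is_sheet U V s -> continuous g ->
  connected S -> (forall z, S z -> U (p (g z))) -> S z0 -> V (g z0) ->
  forall z, S z -> V (g z).
Proof.
move=> [oV oV' _ _ _] cg connS SU Sz0 Vz0.
suff SE : S `&` g @^-1` V = S by move=> z; rewrite -SE => -[].
apply: connS; first by exists z0.
- exists (g @^-1` V) => //.
  by apply: open_comp => // z _; exact: cg.
- exists (~` (g @^-1` (p @^-1` U `\` V))).
    by apply: open_closedC; apply: open_comp => // z _; exact: cg.
  apply/seteqP; split=> z [Sz] /= h; split=> //; first by case.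
  by apply: contrapT => nV; apply: h; split=> //; exact: SU.
Qed.

(** Agreement is locally constant. Where both lifts lie in one sheet they are recovered by [s] from
    their common projection; where [g'] lies off the sheet of [g], it stays off nearby, so the lifts
    differ there. *)
Lemma path_lift_unique (g g' : I -> E) (t0 t : I) :
  continuous g -> continuous g' -> p \o g =1 p \o g' ->
  g t0 = g' t0 -> g t = g' t.
Proof.
move=> cg cg' pgg'; move: t0 t.
apply: (@unit_interval_ind R (fun t => g t = g' t)) => t.
have [U [oU Ugt /(_ _ Ugt)[V [s [Vgt [oV oV' _ _ sK]]]]]] := covering_sheet (p (g t)).
have ngt : nbhs t (g @^-1` V) by apply: cg; exact: open_nbhs_nbhs.
have [Vgt'|nVgt'] := pselect (V (g' t)).
- have ngt' : nbhs t (g' @^-1` V) by apply: cg'; exact: open_nbhs_nbhs.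
  exists (g @^-1` V `&` g' @^-1` V); first exact: filterI.
  move=> u v _ [/= Vv Vv'] _.
  by rewrite -(sK _ Vv) -(sK _ Vv'); congr s; exact: pgg'.
- have ngt' : nbhs t (g' @^-1` (p @^-1` U `\` V)).
    apply: cg'; apply: open_nbhs_nbhs; split=> //; split=> //=.
    by have /= <- := pgg' t.
  exists (g @^-1` V `&` g' @^-1` (p @^-1` U `\` V)); first exact: filterI.
  by move=> u v [/= Vu [_ nVu]] _ uu; case: nVu; rewrite -uu.
Qed.

Lemma path_lift (c : I -> X) (y : E) : continuous c -> p y = c zero ->
  exists g : I -> E, [/\ continuous g, g zero = y & forall t, p (g t) = c t].
Proof.
move=> cc py.
(* A partial lift is a map on all of [I] that is only required to cover [c] up to time [t]; this
   avoids subintervals as domains. *)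
pose P t := exists g : I -> E, [/\ continuous g, g zero = y &
  forall u, ival u <= ival t -> p (g u) = c u].
suff : P one.
  by case=> g [cg g0 pg]; exists g; split=> // t; apply: pg; exact: ival_le1.
have P0 : P zero.
  exists (cst y); split=> [|//|u u0]; first exact: cst_continuous.
   suff -> : u = zero by [].
  rewrite -(ivalK u) clamp0//.
move: P0; apply: unit_interval_ind => t.
have [U [oU Ut US]] := covering_sheet (c t).
have : nbhs t (c @^-1` U) by apply: cc; exact: open_nbhs_nbhs.
move=> /nbhs_ivalP[e e0 eU].
exists [set u | `|ival t - ival u| < e]; first by apply/nbhs_ivalP; exists e.
move=> u v /= tu tv [g [cg g0 pg]].
(* Going back in time, the same partial lift serves; only going forward needs an extension. *)
have [vu|uv] := leP (ival v) (ival u).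
  by exists g; split=> // w wv; apply: pg; exact: le_trans wv vu.
have Ugu : U (p (g u)) by rewrite pg//; exact: eU.
have [V [s [Vgu [oV oV' cs sU sK]]]] := US _ Ugu.
(* [m] retracts [I] onto the interval from [u] to [v], over which [c] stays in [U]. Thus
   [s \o c \o m] is continuous on all of [I] and can be pasted to [g] at [u]. *)
pose m (w : I) : I := clamp (Num.max (ival u) (Num.min (ival w) (ival v))).
have mE w : ival (m w) = Num.max (ival u) (Num.min (ival w) (ival v)).
  rewrite clampK// le_max ival_ge0/= ge_max ival_le1/= ge_min ival_le1//.
have cm : continuous m.
  move=> w; apply: (@continuous_comp I R I
    (cst (ival u) \max (@ival R \min cst (ival v)) : I -> R) (@clamp R) w);
    last exact: clamp_continuous.
  apply: (@continuous_max R I (cst (ival u)) (@ival R \min cst (ival v)) w).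
    exact: cst_continuous.
  apply: (@continuous_min R I (@ival R) (cst (ival v)) w); first exact: ival_continuous.
  exact: cst_continuous.
have mU w : U (c (m w)).
  apply: eU; rewrite mE; move: tu tv; rewrite !ltr_distlC.
  by move=> /andP[tu1 tu2] /andP[tv1 tv2]; rewrite lt_max tu1 /= gt_max tu2 gt_min tv2 orbT.
exists (fun w => if ival w <= ival u then g w else s (c (m w))); split.
- apply: paste_continuous => //.
    move=> w; apply: (@continuous_comp _ _ _ (c \o m) s).
      by apply: continuous_comp; [exact: cm|exact: cc].
    exact/cs/mU.
  have -> : m u = u.
    by apply: (can_inj (@ivalK R)); rewrite mE min_l ?max_l// ltW.
  by rewrite -pg// sK.
- by rewrite ival0 ival_ge0.
- move=> w wv; case: ifPn => [wu|]; first exact: pg.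
  rewrite -ltNge => uw; rewrite (sU _ (mU w)).2; congr c.
  by apply: (can_inj (@ivalK R)); rewrite mE min_l// max_r// ltW.
Qed.

(* Lift each path [H (f, -)]; that the lifts at time [t] depend continuously on [f]
   near a given point is a locally constant property of [t]. *)
Lemma homotopy_lift (F : topologicalType) (H : F * I -> X) (g0 : F -> E) :
  continuous H -> continuous g0 -> (forall f, p (g0 f) = H (f, zero)) ->
  exists G : F * I -> E, [/\ continuous G, forall f, G (f, zero) = g0 f &
    forall z, p (G z) = H z].
Proof.
move=> cH cg0 pg0.
have cHf f : continuous (fun t => H (f, t)).
  apply: (@continuous_compose _ _ _ (pair f)); last exact: cH.
  by apply: continuous_pair; [exact: cst_continuous|exact: continuous_idfun].
have /choice[L LP] f := path_lift (cHf f) (pg0 f).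
exists (fun z => L z.1 z.2).
suff Lc (f : F) (t : I) : {for (f, t), continuous (fun z : F * I => L z.1 z.2)}.
  split=> [[f t]|f|[f t]]; first exact: Lc.
    by have [] := LP f.
  by have [_ _ /(_ t)] := LP f.
pose P t := {for f, continuous (fun f' => L f' t)}.
have step (u : I) : exists2 W, nbhs u W & forall v w, W v -> W w -> P v ->
    {for (f, w), continuous (fun z : F * I => L z.1 z.2)}.
  have [U [oU Ut US]] := covering_sheet (H (f, u)).
  have : nbhs (f, u) (H @^-1` U) by apply: cH; exact: open_nbhs_nbhs.
  move=> [[N W] /= [fN /nbhs_ivalP[e e0 eW]] NWU].
  have eU f' (v : I) : N f' -> `|ival u - ival v| < e -> U (H (f', v)).
    by move=> Nf' uv; apply: (NWU (f', v)); split=> //=; exact: eW.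
  exists [set v | `|ival u - ival v| < e]; first by apply/nbhs_ivalP; exists e.
  move=> v w /= uv uw Pv.
  have Ufv : U (p (L f v)).
    have [_ _ ->] := LP f; apply: eU => //; exact: nbhs_singleton.
  have [V [s [Vfv sh]]] := US _ Ufv.
  have [oV oV' cs sU sK] := sh.
  have fN' : nbhs f (N `&` [set f' | V (L f' v)]).
    by apply: filterI => //; apply: Pv; exact: open_nbhs_nbhs.
  (* [H (f', -)] maps the connected ball into [U], so a lift that meets [V] at time [v] stays in [V]
     and is given there by [s]. This formula is jointly continuous. *)
  have LE f' w' : N f' -> V (L f' v) -> `|ival u - ival w'| < e ->
      L f' w' = s (H (f', w')).
    move=> Nf' Vf' uw'; have [cL _ pL] := LP f'.
    rewrite -pL sK//.
    apply: (sheet_connected sh cL (@ball_unit_interval_connected R u e) _ _ Vf') => //.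
    by move=> z uz; rewrite pL; exact: eU.
  have nw : nbhs w [set w' | `|ival u - ival w'| < e].
    apply/nbhs_ivalP; exists (e - `|ival u - ival w|); first by rewrite subr_gt0.
    move=> w' ww' /=.
    have -> : ival u - ival w' = (ival u - ival w) + (ival w - ival w').
      by rewrite addrA subrK.
    by rewrite (le_lt_trans (ler_normD _ _))// addrC -ltrBrDr.
  have : (s \o H) z @[z --> (f, w)] --> (s \o H) (f, w).
    apply: continuous_comp; first exact: cH.
    by apply: cs; apply: eU => //; exact: nbhs_singleton.
  rewrite /= -LE//; [|exact: nbhs_singleton..].
  apply: cvg_trans; apply: near_eq_cvg.
  exists (N `&` [set f' | V (L f' v)], [set w' | `|ival u - ival w'| < e]) => //=.
  by move=> [f' w'] /= [[Nf' Vf'] uw']; rewrite LE.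
have P0 : P zero.
  rewrite /P (_ : L^~ zero = g0); first exact: cg0.
  by apply/funext => f'; have [] := LP f'.
have PT (u : I) : P u.
  move: P0; apply: unit_interval_ind => {}u; have [W uW WP] := step u.
  exists W => // v w Wv Ww Pv.
  apply: (@continuous_comp _ _ _ (fun f' => (f', w)) (fun z : F * I => L z.1 z.2)).
    by apply: continuous_pair; [exact: continuous_idfun|exact: cst_continuous].
  exact: WP Wv Ww Pv.
by have [W tW /(_ _ _ (nbhs_singleton tW) (nbhs_singleton tW) (PT t))] := step t.
Qed.

End Lifting.

(** * Lifting maps from contractible spaces *)

Section Flip.
Variable R : realType.
Local Notation I := (unit_interval R).

Definition flip (t : I) : I := clamp (1 - ival t).

Lemma ival_flip (t : I) : ival (flip t) = 1 - ival t.
Proof. by rewrite clampK// subr_ge0 ival_le1 lerBlDr lerDl ival_ge0. Qed.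

Lemma flipK : involutive flip.
Proof. by move=> t; apply: (can_inj (@ivalK R)); rewrite !ival_flip subKr. Qed.

Lemma flip0 : flip zero = one.
Proof. by apply: (can_inj (@ivalK R)); rewrite ival_flip ival0 ival1 subr0. Qed.

Lemma flip1 : flip one = zero.
Proof. by rewrite -flip0 flipK. Qed.

Lemma flip_continuous : continuous flip.
Proof.
apply: (@continuous_compose _ R _ (fun t => 1 - ival t)); last exact: clamp_continuous.
move=> t; apply: (@continuousB R R I (cst 1) (@ival R) t).
  exact: cst_continuous.
exact: ival_continuous.
Qed.

Lemma unit_interval_contractible : contractible R I.
Proof.
pose H (z : I * I) : I := clamp (ival z.1 * (1 - ival z.2)).
exists zero, H; split=> [|x|x].
- apply: (@continuous_compose _ R _ (fun z : I * I => ival z.1 * (1 - ival z.2)));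
    last exact: clamp_continuous.
  move=> z; apply: (@continuousM R (I * I)%type (fun z => ival z.1) (fun z => 1 - ival z.2)).
    by apply: (@continuous_comp _ _ _ fst (@ival R)); [exact: cvg_fst|exact: ival_continuous].
  apply: (@continuousB R R (I * I)%type (cst 1) (fun z => ival z.2) z).
    exact: cst_continuous.
  by apply: (@continuous_comp _ _ _ snd (@ival R)); [exact: cvg_snd|exact: ival_continuous].
- by rewrite /H /= ival0 subr0 mulr1 ivalK.
- by rewrite /H /= ival1 subrr mulr0 clamp0.
Qed.

Lemma path_homotopic_comp (S T : topologicalType) (k : S -> T) (f g : I -> S) :
  continuous k -> path_homotopic f g -> path_homotopic (k \o f) (k \o g).
Proof.
move=> ck [H [cH H0 H1 Hz Ho]]; exists (k \o H); split=> /=.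
- exact: continuous_compose cH ck.
- by move=> s; rewrite H0.
- by move=> s; rewrite H1.
- by move=> s; rewrite Hz.
- by move=> s; rewrite Ho.
Qed.

End Flip.

Section ContractibleLifting.
Variables (R : realType) (E X : topologicalType) (p : E -> X).
Hypothesis cov_p : covering p.
Local Notation I := (unit_interval R).

(** The contraction run backwards is a homotopy from a constant map to [g], and a constant map
    lifts. The constant is the endpoint of the lift [L], starting at [e0], of the path traced by
    [z0]; uniqueness of path lifts then brings the resulting lift of [g] back to [e0] at [z0]. *)
Lemma contractible_lift (Z : topologicalType) (g : Z -> X) (z0 : Z) (e0 : E) :
  contractible R Z -> continuous g -> p e0 = g z0 ->
  exists s : Z -> E, [/\ continuous s, forall z, p (s z) = g z & s z0 = e0].
Proof.
move=> [c [H [cH H0 H1]]] cg pe0.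
have cpath : continuous (fun t : I => g (H (z0, t))).
  apply: (continuous_compose _ cg); apply: (continuous_compose _ cH).
  by apply: continuous_pair; [exact: cst_continuous|exact: continuous_idfun].
have [|L [cL L0 pL]] := path_lift cov_p cpath (y := e0); first by rewrite H0.
pose K (z : Z * I) := g (H (z.1, flip z.2)).
have cK : continuous K.
  apply: (continuous_compose _ cg); apply: (continuous_compose _ cH).
  apply: continuous_pair; first by move=> z; exact: cvg_fst.
  apply: (@continuous_compose _ _ _ snd); last exact: flip_continuous.
  by move=> z; exact: cvg_snd.
have [||G [cG G0 pG]] := homotopy_lift cov_p (g0 := cst (L one)) cK.
- exact: cst_continuous.
- by move=> z; rewrite pL /K /= flip0 !H1.
have cG1 t : continuous (fun z => G (z, t)).
  apply: (continuous_compose _ cG).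
  by apply: continuous_pair; [exact: continuous_idfun|exact: cst_continuous].
exists (fun z => G (z, one)); split=> // [z|]; first by rewrite pG /K /= flip1 H0.
have cGz : continuous (fun t => G (z0, flip t)).
  apply: (continuous_compose _ cG).
  by apply: continuous_pair; [exact: cst_continuous|exact: flip_continuous].
rewrite -L0 -flip0.
apply: (path_lift_unique cov_p (t0 := one) zero cGz cL); last by rewrite flip1 G0.
by move=> t /=; rewrite pG pL /K /= flipK.
Qed.

(** Agreement travels along the contraction from [z0] to the centre [c], and from there back to
    [z]. *)
Lemma contractible_lift_unique (Z : topologicalType) (g g' : Z -> E) (z0 z : Z) :
  contractible R Z -> continuous g -> continuous g' -> p \o g =1 p \o g' ->
  g z0 = g' z0 -> g z = g' z.
Proof.
move=> [c [H [cH H0 H1]]] cg cg' pgg' gg'0.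
have cHz x : continuous (fun t : I => H (x, t)).
  apply: (continuous_compose _ cH).
  by apply: continuous_pair; [exact: cst_continuous|exact: continuous_idfun].
have step x (s t : I) : g (H (x, s)) = g' (H (x, s)) -> g (H (x, t)) = g' (H (x, t)).
  apply: (path_lift_unique (g := fun t => g (H (x, t))) (g' := fun t => g' (H (x, t))) cov_p).
  - exact: continuous_compose (cHz x) cg.
  - exact: continuous_compose (cHz x) cg'.
  - by move=> u; exact: pgg'.
rewrite -(H0 z); apply: (step z one); rewrite H1 -(H1 z0).
by apply: (step z0 zero); rewrite H0.
Qed.

(** Lift the homotopy starting from [g]. Its other three sides project to constant paths, so they
    are constant themselves, and together they join the two ends of [g]. *)
Lemma nullhomotopic_lift_closed (g : I -> E) : continuous g ->
  path_homotopic (p \o g) (cst (p (g zero))) -> g zero = g one.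
Proof.
move=> cg [H [cH H0 H1 Hz Ho]].
have [|G [cG G0 pG]] := homotopy_lift cov_p cH cg; first by move=> s; rewrite H0.
have cGs s : continuous (fun t => G (s, t)).
  apply: (continuous_compose _ cG).
  by apply: continuous_pair; [exact: cst_continuous|exact: continuous_idfun].
have cGt t : continuous (fun s => G (s, t)).
  apply: (continuous_compose _ cG).
  by apply: continuous_pair; [exact: continuous_idfun|exact: cst_continuous].
have cc y : continuous (fun _ : I => y : E) by exact: cst_continuous.
have -> : g zero = G (zero, one).
  rewrite -G0; apply: (path_lift_unique cov_p (t0 := zero) one (cc _) (cGs zero)) => //.
  by move=> t /=; rewrite !pG !Hz.
have -> : g one = G (one, one).
  rewrite -G0; apply: (path_lift_unique cov_p (t0 := zero) one (cc _) (cGs one)) => //.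
  by move=> t /=; rewrite !pG !Ho.
apply: (path_lift_unique cov_p (t0 := zero) one (cc _) (cGt one)) => //.
by move=> t /=; rewrite !pG !H1.
Qed.

End ContractibleLifting.

(** * Comparison of universal coverings *)

Section Comparison.
Variables (R : realType) (F D E A : topologicalType).
Variables (q : F -> D) (p : E -> A) (h : D -> A).
Local Notation I := (unit_interval R).

(** Here [r] lifts [h \o q]. If [r a = r b], a path from [a] to [b] becomes a loop in the simply
    connected [E], so its image under [h \o q] is null-homotopic; by injectivity on fundamental
    groups the loop in [D] is null-homotopic too, and the path closes up. It serves with [h] an
    inclusion, for mirrors, and with [h] the identity, for two universal coverings of one space. *)
Lemma universal_covering_comparison (f0 : F) (e0 : E) :
  universal_covering R q -> contractible R F -> universal_covering R p ->
  continuous h -> injective h -> pi1_injective R h -> h (q f0) = p e0 ->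
  exists r : F -> E, [/\ continuous r, injective r, r f0 = e0,
    forall f, p (r f) = h (q f) &
    forall (Z : topologicalType) (g : Z -> E) (g' : Z -> D) z0 f1,
      contractible R Z -> continuous g -> continuous g' ->
      (forall z, p (g z) = h (g' z)) -> r f1 = g z0 ->
      exists k : Z -> F, continuous k /\ forall z, r (k z) = g z].
Proof.
move=> [cov_q [[_ pcF] _]] ctrF [cov_p [_ scE]] ch injh pih h0.
have cq : continuous q by case: cov_q.
have cp : continuous p by case: cov_p.
have [r [cr pr r0]] := contractible_lift cov_p ctrF (continuous_compose cq ch) (esym h0).
exists r; split=> //.
- move=> a b rab; have [gm] := pcF a b.
  have cgm : continuous gm by exact: cts_fun.
  have qab : q b = q a by apply: injh; rewrite -!pr rab.
  have ga : gm zero = a by rewrite path_zero.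
  have gb : gm one = b by rewrite path_one.
  suff : gm zero = gm one by rewrite ga gb.
  apply: (nullhomotopic_lift_closed cov_q cgm).
  have cqg := continuous_compose cgm cq.
  have q0 : q (gm zero) = q a by rewrite ga.
  have q1 : q (gm one) = q a by rewrite gb.
  pose l : {path I from q a to q a} := mk_path cqg q0 q1.
  pose l' : {path I from q a to q a} := cst (q a).
  rewrite ga; apply: (pih _ l l').
  have crg := continuous_compose cgm cr.
  have r1 : r (gm zero) = r a by rewrite ga.
  have r2 : r (gm one) = r a by rewrite gb.
  pose m : {path I from r a to r a} := mk_path crg r1 r2.
  pose m' : {path I from r a to r a} := cst (r a).
  have := path_homotopic_comp cp (scE _ m m').
  have -> : p \o m = h \o l by apply/funext => t; exact: pr.
  by have -> : p \o m' = h \o l' by apply/funext => t; exact: pr.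
(* Lift [g'] to [F] through [f1]; the [r]-image of this lift and [g] are lifts of the same map to
   [A] that agree at [z0]. *)
- move=> Z g g' z0 f1 ctrZ cg cg' pg rf1.
  have qf1 : q f1 = g' z0 by apply: injh; rewrite -pr rf1.
  have [k [ck qk k0]] := contractible_lift cov_q ctrZ cg' qf1.
  exists k; split=> // z.
  apply: (@contractible_lift_unique R E A p cov_p Z (fun x => r (k x)) g z0 z ctrZ) => //.
  + exact: continuous_compose ck cr.
  + by move=> y /=; rewrite pr qk pg.
  + by rewrite /= k0.
Qed.

End Comparison.

(** * Acyclicity from a cone operator *)

HB.instance Definition _ (K : choiceType) (M : lmodType int) (f : K -> M) :=
  GRing.isAdditive.Build {freeg K / int} M (fglift f) (lift_is_additive f).

Lemma freeg_additive_ext (S : choiceType) (M : lmodType int)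
    (f g : {additive {freeg S / int} -> M}) :
  (forall x, f << x >> = g << x >>) -> f =1 g.
Proof.
move=> fg d; rewrite -(freeg_sumE d) !raddf_sum; apply: eq_bigr => x _.
by rewrite -[coeff _ _]intz -freegU_mulz !raddfMz fg.
Qed.

Section ConeAcyclic.
Variables (R : realType) (T : topologicalType).
Local Notation simplex k := (singular_simplex R T k).
Local Notation chain k := (singular_chain R T k).

HB.instance Definition _ k :=
  GRing.isAdditive.Build (chain k.+1) (chain k) (@boundary R T k)
    (lift_is_additive _).

(** Face 0 is set apart because it is the base of a cone whose apex is vertex 0. *)
Lemma boundaryU k (s : simplex k.+1) : boundary << s >> =
  << singular_face ord0 s >> -
  \sum_(i < k.+1) (-1) ^+ i *: << singular_face (fintype.lift ord0 i) s >> :> chain k.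
Proof.
rewrite /boundary liftU scale1r big_ord_recl /= expr0 scale1r -sumrN; congr (_ + _).
by apply: eq_bigr => i _; rewrite /bump leq0n add1n exprS mulN1r scaleNr.
Qed.

Variables (c : simplex 0) (K : forall k, simplex k -> simplex k.+1).
Hypothesis face0K : forall k (s : simplex k), singular_face ord0 (K s) = s.
Hypothesis faceSK : forall k (s : simplex k.+1) (i : 'I_k.+2),
  singular_face (fintype.lift ord0 i) (K s) = K (singular_face i s).
Hypothesis face1K : forall (s : simplex 0),
  singular_face (fintype.lift ord0 ord0) (K s) = c.

(** The linear extension of [K] is a contraction of the augmented complex: the boundary of the cone
    on [d] is [d] minus the cone on the boundary of [d], or minus [deg d] copies of [c] in degree 0.
    Hence a cycle, of degree 0 if it is a 0-chain, bounds its own cone. Both identities are additive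
    and need checking only on simplices. *)
Lemma acyclic_cone : acyclic R T.
Proof.
pose cone k : chain k -> chain k.+1 := fglift (fun s => << K s >>).
have coneE k s : cone k << s >> = << K s >> by rewrite /cone liftU scale1r.
have bc0 : (fun d => boundary (cone 0%N d) : chain 0) =1 (fun d => d - << c >> *~ deg d).
  pose f : {additive chain 0 -> chain 0} := @boundary R T 0 \o cone 0%N.
  pose g' : {additive chain 0 -> chain 0} := intmul << c >> \o @deg _.
  pose g : {additive chain 0 -> chain 0} := idfun \- g'.
  apply: (@freeg_additive_ext _ _ f g) => s; rewrite /f /g /g' /=.
  rewrite liftU scale1r boundaryU face0K big_ord1 expr0 scale1r face1K.
  by rewrite degU mulr1z.
have bc k : (fun d => boundary (cone k.+1 d) : chain k.+1) =1
    (fun d => d - cone k (boundary d)).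
  pose f : {additive chain k.+1 -> chain k.+1} := @boundary R T k.+1 \o cone k.+1.
  pose g' : {additive chain k.+1 -> chain k.+1} := cone k \o @boundary R T k.
  pose g : {additive chain k.+1 -> chain k.+1} := idfun \- g'.
  apply: (@freeg_additive_ext _ _ f g) => s; rewrite /f /g /g' /=.
  rewrite liftU scale1r boundaryU face0K; congr (_ - _).
  rewrite [in RHS]/boundary liftU scale1r raddf_sum; apply: eq_bigr => i _.
  rewrite raddfZsign /=. rewrite faceSK; congr (_ *: _). exact: esym (coneE _ _).
split.
- by exists << c >>; rewrite degU.
- by move=> d d0; exists (cone 0%N d); rewrite bc0 d0 mulr0z subr0.
- by move=> k d d0; exists (cone k.+1 d); rewrite bc d0 /cone raddf0 subr0.
Qed.

End ConeAcyclic.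

(** * Standard simplices and cones on singular simplices *)

Lemma row_continuous (R : realType) (T : topologicalType) n (f : T -> 'rV[R]_n) :
  (forall j, continuous (fun x => f x 0 j)) -> continuous f.
Proof.
move=> cf x U [P xP PU]; apply: (@filterS _ (nbhs x) _
  [set y | forall j, P 0 j (f y 0 j)]).
  by move=> y yP; apply: PU => i j; rewrite ord1.
by apply: filter_forall => j; exact: (cf j x _ (xP 0 j)).
Qed.

Section StandardSimplex.
Variable R : realType.
Local Notation I := (unit_interval R).
Local Notation simplex k := (@std_simplex R k).

Definition bary k (t : simplex k) (i : 'I_k.+1) : R := set_val t 0 i.

Lemma bary_ge0 k (t : simplex k) i : 0 <= bary t i.
Proof. by have [+ _] : std_simplex (set_val t) := set_valP t; apply. Qed.

Lemma bary_sum k (t : simplex k) : \sum_i bary t i = 1.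
Proof. by have [] : std_simplex (set_val t) := set_valP t. Qed.

Lemma bary_continuous k (i : 'I_k.+1) : continuous (fun t : simplex k => bary t i).
Proof.
apply: (@continuous_compose _ _ _ set_val (fun v : 'rV[R]_k.+1 => v 0 i)).
  exact: initial_continuous.
exact: coord_continuous.
Qed.

Lemma bary_inj k (s t : simplex k) : bary s =1 bary t -> s = t.
Proof.
by move=> st; apply: val_inj; apply/rowP => j; exact: st.
Qed.

Lemma simplex_subproof k (b : 'I_k.+1 -> R) :
  (forall i, 0 <= b i) -> \sum_i b i = 1 -> \row_i b i \in simplex k.
Proof.
move=> b0 b1; rewrite inE; split=> [i|]; first by rewrite mxE.
by rewrite -b1; apply: eq_bigr => i _; rewrite mxE.
Qed.

Definition mk_simplex k b (b0 : forall i, 0 <= b i) (b1 : \sum_i b i = 1) : simplex k :=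
  exist _ (\row_i b i) (simplex_subproof b0 b1).

Lemma bary_mk k b b0 b1 i : bary (@mk_simplex k b b0 b1) i = b i.
Proof. by rewrite /bary set_valE /= mxE. Qed.

Lemma simplex_continuous k (T : topologicalType) (f : T -> simplex k) :
  (forall i, continuous (fun x => bary (f x) i)) -> continuous f.
Proof. by move=> cf; apply: continuous_comp_initial; exact: row_continuous. Qed.

Lemma bary_coface k (i : 'I_k.+2) (t : simplex k) (j : 'I_k.+2) :
  bary (coface i t) j = if unlift i j is Some j' then bary t j' else 0.
Proof. by rewrite /bary set_valE /= mxE. Qed.

Lemma std_simplex_contractible k : contractible R (simplex k).
Proof.
pose b (z : simplex k * I) (i : 'I_k.+1) :=
  (1 - ival z.2) * bary z.1 i + ival z.2 * (i == ord0)%:R.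
have b0 z i : 0 <= b z i.
  by rewrite addr_ge0// mulr_ge0 ?subr_ge0 ?ival_ge0 ?ival_le1 ?bary_ge0// ler0n.
have sum_vtx : \sum_(i < k.+1) (i == ord0)%:R = 1 :> R.
  by rewrite (bigD1 ord0)//= big1 ?addr0// => i /negbTE ->.
have b1 z : \sum_i b z i = 1.
  by rewrite big_split/= -!mulr_sumr bary_sum sum_vtx !mulr1 subrK.
have v0 i : 0 <= (i == ord0 :> 'I_k.+1)%:R :> R by [].
exists (mk_simplex v0 sum_vtx), (fun z => mk_simplex (b0 z) (b1 z)); split.
- apply: simplex_continuous => i; under eq_fun do rewrite bary_mk.
  have c2 : continuous (fun z : simplex k * I => ival z.2).
    apply: (@continuous_compose _ _ _ snd); last exact: ival_continuous.
    by move=> z; exact: cvg_snd.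
  have c1 : continuous (fun z : simplex k * I => bary z.1 i).
    apply: (@continuous_compose _ _ _ fst (fun t : simplex k => bary t i)).
      by move=> z; exact: cvg_fst.
    exact: bary_continuous.
  move=> z; apply: (@continuousD R R _ (fun z => (1 - ival z.2) * bary z.1 i)
    (fun z => ival z.2 * (i == ord0)%:R)).
    apply: (@continuousM R _ (fun z => 1 - ival z.2) (fun z => bary z.1 i)); last exact: c1.
    apply: (@continuousB R R _ (cst 1) (fun z => ival z.2)); last exact: c2.
    exact: cst_continuous.
  apply: (@continuousM R _ (fun z => ival z.2) (cst (i == ord0)%:R)); first exact: c2.
  exact: cst_continuous.
- by move=> x; apply: bary_inj => i; rewrite bary_mk /b /= ival0 subr0 mul1r mul0r addr0.
- by move=> x; apply: bary_inj => i; rewrite !bary_mk /b /= ival1 subrr mul1r mul0r add0r.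
Qed.

(* The radial projection from the vertex 0 to the opposite face, altered where the
   coordinate at that vertex exceeds 1/2 so as to be continuous everywhere. *)
Section Projection.
Variable k : nat.
Implicit Types t : simplex k.+1.

Let den t := Num.max (1 - bary t ord0) 2^-1.
(** The excess of [den] over [1 - bary t ord0]. Adding it to coordinate 0 keeps the sum of the
    coordinates equal to 1 once the denominator stops decreasing at 1/2. *)
Let ext t := Num.max 0 (bary t ord0 - 2^-1).
Let num t (i : 'I_k.+1) := bary t (fintype.lift ord0 i) + (i == ord0)%:R * ext t.

Let den_gt0 t : 0 < den t.
Proof. by rewrite lt_max invr_gt0 ltr0n orbT. Qed.

Let proj_ge0 t i : 0 <= num t i / den t.
Proof.
by rewrite divr_ge0 ?(ltW (den_gt0 t))// addr_ge0 ?bary_ge0// mulr_ge0// le_max lexx.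
Qed.

Let proj_sum t : \sum_i num t i / den t = 1.
Proof.
rewrite -mulr_suml big_split/=.
have -> : \sum_(i < k.+1) (i == ord0)%:R * ext t = ext t.
  by rewrite (bigD1 ord0)//= mul1r big1 ?addr0// => i /negbTE ->; rewrite mul0r.
have := bary_sum t; rewrite big_ord_recl => t1.
suff -> : \sum_(i < k.+1) bary t (fintype.lift ord0 i) + ext t = den t.
  by rewrite divff// gt_eqF.
rewrite (_ : \sum_(i < k.+1) _ = 1 - bary t ord0); last by rewrite -t1 addrC addKr.
by rewrite /ext /den addr_maxr addr0; congr Num.max; lra.
Qed.

Definition vertex_proj t : simplex k := mk_simplex (proj_ge0 t) (proj_sum t).

Lemma vertex_proj_continuous : continuous vertex_proj.
Proof.
apply: simplex_continuous => i; under eq_fun do rewrite bary_mk.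
have cd : continuous den.
  move=> t; apply: (@continuous_max R _ (fun t => 1 - bary t ord0) (cst 2^-1)).
    apply: (@continuousB R R _ (cst 1) (fun t => bary t ord0)); first exact: cst_continuous.
    exact: bary_continuous.
  exact: cst_continuous.
have ce : continuous ext.
  move=> t; apply: (@continuous_max R _ (cst 0) (fun t => bary t ord0 - 2^-1)).
    exact: cst_continuous.
  apply: (@continuousB R R _ (fun t => bary t ord0) (cst 2^-1)); last exact: cst_continuous.
  exact: bary_continuous.
move=> t; apply: (@continuousM R _ (fun t => num t i) (fun t => (den t)^-1)).
  apply: (@continuousD R R _ (fun t => bary t (fintype.lift ord0 i))
    (fun t => (i == ord0)%:R * ext t)); first exact: bary_continuous.
  by apply: (@continuousM R _ (cst (i == ord0)%:R) ext); [exact: cst_continuous|exact: ce].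
by apply: (@continuousV R _ den); [rewrite gt_eqF|exact: cd].
Qed.

Lemma vertex_proj_le t : bary t ord0 <= 2^-1 ->
  forall i, bary (vertex_proj t) i = bary t (fintype.lift ord0 i) / (1 - bary t ord0).
Proof.
move=> t2 i; rewrite bary_mk /num /ext /den max_l; last by lra.
by rewrite mulr0 addr0 max_l//; lra.
Qed.

End Projection.

Lemma vertex_proj_coface0 k (t : simplex k) : vertex_proj (coface ord0 t) = t.
Proof.
have t0 : bary (coface ord0 t) ord0 = 0 by rewrite bary_coface unlift_none.
apply: bary_inj => i; rewrite vertex_proj_le t0 ?invr_ge0 ?ler0n//.
by rewrite subr0 divr1 bary_coface liftK.
Qed.

Lemma bary_cofaceS0 k (i : 'I_k.+2) (t : simplex k.+1) :
  bary (coface (fintype.lift ord0 i) t) ord0 = bary t ord0.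
Proof.
rewrite bary_coface; case: unliftP => [j jE|/eqP//].
suff -> : j = ord0 by [].
by apply: (@lift_inj _ (fintype.lift ord0 i)); rewrite -jE; apply: val_inj.
Qed.

(** The bound on [bary t ord0] matters: beyond 1/2 an excess sits on coordinate 0, and [coface i]
    with [i = 0] would move it to coordinate 1. *)
Lemma vertex_proj_cofaceS k (i : 'I_k.+2) (t : simplex k.+1) : bary t ord0 <= 2^-1 ->
  vertex_proj (coface (fintype.lift ord0 i) t) = coface i (vertex_proj t).
Proof.
move=> t2; apply: bary_inj => j; rewrite vertex_proj_le bary_cofaceS0//.
rewrite !bary_coface; case: (unliftP i j) => [j' ->|->]; last by rewrite unlift_none mul0r.
(* The simplicial identity between cofaces. *)
have -> : fintype.lift ord0 (fintype.lift i j') =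
    fintype.lift (fintype.lift ord0 i) (fintype.lift ord0 j') :> 'I_k.+3.
  by apply: val_inj; rewrite /= /bump !leq0n !add1n ltnS; case: leqP.
by rewrite liftK vertex_proj_le.
Qed.

End StandardSimplex.

(** The cone on a simplex of [T] is formed in [F], by contracting its lift, and pushed back by [r].
    Injectivity of [r] makes lifts unique, so that lifting commutes with taking faces. *)
Lemma acyclic_of_simplex_lift (R : realType) (F T : topologicalType) (r : F -> T) :
  contractible R F -> continuous r -> injective r ->
  (forall k (s : singular_simplex R T k),
    exists g : @std_simplex R k -> F, continuous g /\ forall t, r (g t) = s t) ->
  acyclic R T.
Proof.
move=> [c [H [cH H0 H1]]] cr injr Tlift.
have L k : {L : singular_simplex R T k -> @std_simplex R k -> F |
    forall s, continuous (L s) /\ forall t, r (L s t) = s t}.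
  by apply: cid; have [L LP] := choice (Tlift k); exists L.
pose lft k := sval (L k).
have clft k s : continuous (lft k s) by case: (svalP (L k) s).
have lftE k s t : r (lft k s t) = s t by case: (svalP (L k) s) => _; exact.
(* The factor 2 ends the contraction at coordinate 1/2, just where [vertex_proj] stops being the
   radial projection; from there on the cone is constantly [r c], and the altered values have no
   effect. *)
pose coneF k (s : singular_simplex R T k) (t : @std_simplex R k.+1) : T :=
  r (H (lft k s (vertex_proj t), clamp (2 * bary t ord0))).
have ccone k s : continuous (@coneF k s).
  apply: (continuous_compose _ cr); apply: (continuous_compose _ cH).
  apply: continuous_pair.
    by apply: continuous_compose; [exact: vertex_proj_continuous|exact: clft].
  apply: (continuous_compose _ (@clamp_continuous R)) => t.
  apply: (@continuousM R _ (cst 2) (fun t => bary t ord0)); first exact: cst_continuous.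
  exact: bary_continuous.
pose K k (s : singular_simplex R T k) : singular_simplex R T k.+1 := mkcts (@ccone k s).
pose c0 : singular_simplex R T 0 := cst (r c).
apply: (@acyclic_cone R T c0 K).
- move=> k s; apply/continuousEP => t; rewrite /= /mkcts /coneF vertex_proj_coface0.
  by rewrite bary_coface unlift_none mulr0 clamp0// H0 lftE.
- move=> k s i; apply/continuousEP => t; rewrite /= /mkcts /coneF bary_cofaceS0.
  have [t2|t2] := leP (bary t ord0) 2^-1.
    rewrite vertex_proj_cofaceS//; congr (r (H (_, _))).
    by apply: injr; rewrite !lftE.
  rewrite clamp1 ?H1//; lra.
- move=> s; apply/continuousEP => t; rewrite /= /mkcts /coneF.
  have -> : bary (coface (fintype.lift ord0 ord0) t) ord0 = 1.
    rewrite bary_coface; case: unliftP => [j _|/eqP//].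
    by rewrite -(bary_sum t) big_ord1; congr bary; rewrite ord1.
  by rewrite mulr1 clamp1 ?H1// ler1n.
Qed.

(** * Path components and products *)

(** Choice for a family whose type varies with the index, used to treat all factors of a product at
    once; not the axiom of dependent choice for sequences. *)
Lemma dependent_choice_fun (I : Type) (T : I -> Type) (P : forall i, T i -> Prop) :
  (forall i, exists x, P i x) -> exists f : forall i, T i, forall i, P i (f i).
Proof. by move=> exP; exists (fun i => sval (cid (exP i))) => i; case: cid. Qed.

Section PathComponents.
Variable R : realType.
Local Notation I := (unit_interval R).

Lemma path_componentP (T : topologicalType) (S : set T) (x y : T) :
  path_component R S x y <->
  exists f : I -> T, [/\ continuous f, f zero = x, f one = y & forall t, S (f t)].
Proof.
split=> [[f fS]|[f [cf f0 f1 fS]]].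
  exists f; split; [exact: cts_fun|exact: path_zero|exact: path_one|].
  by move=> t; apply: fS; exists t.
by exists (mk_path cf f0 f1 : {path I from x to y}) => _ [t _ <-]; exact: fS.
Qed.

Lemma path_component_refl (T : topologicalType) (S : set T) x :
  S x -> path_component R S x x.
Proof.
move=> Sx; apply/path_componentP; exists (cst x); split=> //.
exact: cst_continuous.
Qed.

Lemma path_component_sub (T : topologicalType) (S : set T) x y :
  path_component R S x y -> S y.
Proof. by move=> /path_componentP[f [_ _ <-]]. Qed.

Lemma path_component_prefix (T : topologicalType) (S : set T) (f : I -> T) t :
  continuous f -> (forall u, S (f u)) -> path_component R S (f zero) (f t).
Proof.
move=> cf fS; apply/path_componentP.
exists (fun u => f (clamp (ival u * ival t))); split=> //.
- apply: (continuous_compose _ cf); apply: (continuous_compose _ (@clamp_continuous R)).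
  move=> u; apply: (@continuousM R I (@ival R) (cst (ival t))); last exact: cst_continuous.
  exact: ival_continuous.
- by rewrite ival0 mul0r clamp0.
- by rewrite ival1 mul1r ivalK.
Qed.

Lemma path_component_sym (T : topologicalType) (S : set T) x y :
  path_component R S x y -> path_component R S y x.
Proof.
move=> /path_componentP[f [cf f0 f1 fS]]; apply/path_componentP.
exists (f \o @flip R); split=> /=; rewrite ?flip0 ?flip1//.
by apply: (continuous_compose _ cf); exact: flip_continuous.
Qed.

Lemma path_component_trans (T : topologicalType) (S : set T) x y z :
  path_component R S x y -> path_component R S y z -> path_component R S x z.
Proof.
move=> /path_componentP[f [cf f0 f1 fS]] /path_componentP[g [cg g0 g1 gS]].
apply/path_componentP.
have half01 : (0 <= 2^-1 :> R) && (2^-1 <= 1 :> R).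
  by rewrite invr_ge0 ler0n invf_le1 ?ltr0n// ler1n.
have c2 : continuous (fun t : I => 2 * ival t).
  move=> t; apply: (@continuousM R I (cst 2) (@ival R)); first exact: cst_continuous.
  exact: ival_continuous.
exists (fun t => if ival t <= ival (clamp (2^-1 : R)) then f (clamp (2 * ival t))
  else g (clamp (2 * ival t - 1))); split.
- apply: paste_continuous.
  + apply: (continuous_compose _ cf).
    by apply: (continuous_compose c2); exact: clamp_continuous.
  + apply: (continuous_compose _ cg).
    apply: (continuous_compose (f := fun t => 2 * ival t - 1)); last exact: clamp_continuous.
    move=> t; apply: (@continuousB R R I (fun t => 2 * ival t) (cst 1)); first exact: c2.
    exact: cst_continuous.
  + by rewrite clampK// divff ?pnatr_eq0// subrr clamp1// clamp0// f1 g0.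
- by rewrite clampK// ival0 invr_ge0 ler0n mulr0 clamp0.
- rewrite clampK// ival1 mulr1 ifN; last by lra.
  by rewrite clamp1 ?g1//; lra.
- by move=> t; case: ifP.
Qed.

Lemma path_component_eq (T : topologicalType) (S : set T) x y :
  path_component R S x y -> path_component R S x = path_component R S y.
Proof.
move=> xy; apply/seteqP; split=> z; apply: path_component_trans => //.
exact: path_component_sym.
Qed.

Lemma path_connectedP (T : topologicalType) (x y : T) : path_connected R T ->
  exists f : I -> T, [/\ continuous f, f zero = x & f one = y].
Proof.
move=> [_ /(_ x y)[f]]; exists f.
by split; [exact: cts_fun|exact: path_zero|exact: path_one].
Qed.

End PathComponents.

(** * Products of coverings and of contractible spaces *)

Section Products.
Variable R : realType.
Local Notation I := (unit_interval R).

(** The pointwise form is for local sections of a covering, which are continuous only over the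
    evenly covered set. *)
Lemma prod_topology_continuous_at (J : eqType) (A : J -> topologicalType)
    (U : topologicalType) (g : U -> prod_topology A) (u : U) :
  (forall i, {for u, continuous (fun u => g u i)}) -> {for u, continuous g}.
Proof.
move=> gc; have FF : Filter (g @ u) := fmap_filter _ (nbhs_filter u).
apply: (iffRL (@cvg_sup _ _ _ (g @ u) (g u) FF)) => i W.
rewrite nbhsE => -[V [[V' oV' <-] V'gu] VW].
apply: filterS VW _; apply: (gc i V').
exact: open_nbhs_nbhs.
Qed.

Lemma proj_compose_continuous (J : eqType) (A : J -> topologicalType)
    (U : topologicalType) (g : U -> prod_topology A) i :
  continuous g -> continuous (fun u => g u i).
Proof.
move=> cg; apply: (@continuous_compose U (prod_topology A) (A i) g (fun x => x i)) => //.
exact: proj_continuous.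
Qed.

Lemma prod_map_continuous (J : eqType) (A E : J -> topologicalType)
    (p : forall i, E i -> A i) : (forall i, continuous (p i)) ->
  continuous (fun (x : prod_topology E) => (fun i => p i (x i)) : prod_topology A).
Proof.
move=> cp; apply: prod_topology_continuous => i.
apply: (@continuous_compose (prod_topology E) (E i) (A i) (fun x => x i)) => //.
exact: proj_continuous.
Qed.

(** Finiteness of [J] is what makes a box of open sets open in the product topology. *)
Lemma prod_open (J : finType) (A : J -> topologicalType) (U : forall i, set (A i)) :
  (forall i, open (U i)) -> open [set x : prod_topology A | forall i, U i (x i)].
Proof.
move=> oU; rewrite openE => x Ux; rewrite /interior /=.
have := @filter_forall _ J (fun i y => U i (y i)) (nbhs x) _; apply=> i.
exact: (proj_continuous (open_nbhs_nbhs (conj (oU i) (Ux i)))).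
Qed.

Lemma contractible_prod (J : eqType) (A : J -> topologicalType) :
  (forall i, contractible R (A i)) -> contractible R (prod_topology A).
Proof.
move=> /dependent_choice_fun[c /dependent_choice_fun[H HP]].
exists c, (fun z i => H i (z.1 i, z.2)); split=> [|x|x].
- apply: prod_topology_continuous => i.
  have [cH _ _] := HP i; apply: (continuous_compose _ cH).
  apply: continuous_pair; last by move=> z; exact: cvg_snd.
  apply: proj_compose_continuous; move=> z; exact: cvg_fst.
- by apply: functional_extensionality_dep => i; have [_ ->] := HP i.
- by apply: functional_extensionality_dep => i; have [_ _ ->] := HP i.
Qed.

Lemma path_connected_prod (J : eqType) (A : J -> topologicalType) :
  (forall i, path_connected R (A i)) -> path_connected R (prod_topology A).
Proof.
move=> pcA; split=> [|x y].
  by have [x _] := dependent_choice_fun (fun i => (pcA i).1); exists x.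
have [f fP] := dependent_choice_fun (fun i => path_connectedP (x i) (y i) (pcA i)).
pose g (t : I) : prod_topology A := fun i => f i t.
have cg : continuous g by apply: prod_topology_continuous => i; have [] := fP i.
have g0 : g zero = x.
  by apply: functional_extensionality_dep => i; have [] := fP i.
have g1 : g one = y.
  by apply: functional_extensionality_dep => i; have [] := fP i.
by split; exact: (mk_path cg g0 g1 : {path _ from x to y}).
Qed.

Lemma simply_connected_prod (J : eqType) (A : J -> topologicalType) :
  (forall i, simply_connected R (A i)) -> simply_connected R (prod_topology A).
Proof.
move=> scA; split; first by apply: path_connected_prod => i; have [] := scA i.
move=> x f g.
have hfg i : path_homotopic (fun t => f t i) (fun t => g t i).
  have cf : continuous (fun t => f t i) by apply: proj_compose_continuous; exact: cts_fun.
  have cg : continuous (fun t => g t i) by apply: proj_compose_continuous; exact: cts_fun.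
  have f0 : f zero i = x i by rewrite path_zero.
  have f1 : f one i = x i by rewrite path_one.
  have g0 : g zero i = x i by rewrite path_zero.
  have g1 : g one i = x i by rewrite path_one.
  exact: ((scA i).2 (x i) (mk_path cf f0 f1) (mk_path cg g0 g1)).
have [H HP] := dependent_choice_fun hfg.
exists (fun z i => H i z); split.
- by apply: prod_topology_continuous => i; have [] := HP i.
- by move=> s; apply: functional_extensionality_dep => i; have [_ ->] := HP i.
- by move=> s; apply: functional_extensionality_dep => i; have [_ _ ->] := HP i.
- by move=> s; apply: functional_extensionality_dep => i; have [_ _ _ ->] := HP i.
- by move=> s; apply: functional_extensionality_dep => i; have [_ _ _ _ ->] := HP i.
Qed.

(** A box of evenly covered sets, open because [J] is finite, is evenly covered by the boxes of
    sheets. Choice picks the sets [U i] and their families of sheets. *)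
Lemma covering_prod (J : finType) (A E : J -> topologicalType)
    (p : forall i, E i -> A i) : (forall i, covering (p i)) ->
  covering (fun (x : prod_topology E) => (fun i => p i (x i)) : prod_topology A).
Proof.
move=> cov; set P := (X in covering X).
have cP : continuous P by apply: prod_map_continuous => i; have [] := cov i.
split=> // [|x].
  apply/seteqP; split=> // x _.
  have [i|y yP] := @dependent_choice_fun J (fun i => E i) (fun i y => p i y = x i).
    by have [_ pT _] := cov i; have [y _ <-] : range (p i) (x i) by [rewrite pT]; exists y.
  by exists y => //; apply: functional_extensionality_dep.
have [i|U UP] := @dependent_choice_fun J (fun i => set (A i))
  (fun i U => [/\ open U, U (x i) & evenly_covered (p i) U]).
  by have [_ _] := cov i; exact.
have [i|S SP] := @dependent_choice_fun J (fun i => set (set (E i)))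
  (fun i S => [/\ p i @^-1` U i = \bigcup_(V in S) V, trivIset S id
    & forall V, S V -> open V /\ restricts_to_homeo (p i) V (U i)]).
  by have [] := UP i.
have oU : open [set x : prod_topology A | forall i, U i (x i)].
  by apply: prod_open => i; have [] := UP i.
exists [set x | forall i, U i (x i)]; split=> //; first by move=> i; have [] := UP i.
exists [set W | exists V : forall i, set (E i), (forall i, S i (V i)) /\
  W = [set y | forall i, V i (y i)]]; split.
- apply/seteqP; split=> y /=.
    move=> Uy; have [i|V VP] := @dependent_choice_fun J (fun i => set (E i))
      (fun i V => S i V /\ V (y i)).
      have [SU _ _] := SP i; have : (p i @^-1` U i) (y i) by exact: Uy.
      by rewrite SU => -[V SV Vy]; exists V.
    exists [set y | forall i, V i (y i)] => [|i]; last by have [] := VP i.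
    by exists V; split=> // i; have [] := VP i.
  move=> [_ [V [SV ->]] Vy] i; have [SU _ _] := SP i.
  suff : (p i @^-1` U i) (y i) by [].
  by rewrite SU; exists (V i).
- move=> _ _ [V [SV ->]] [V' [SV' ->]] [y [Vy V'y]].
  suff -> : V = V' by [].
  apply: functional_extensionality_dep => i; have [_ tS _] := SP i.
  by apply: tS => //; exists (y i).
- move=> _ [V [SV ->]].
  have oV i : open (V i) by have [_ _ /(_ _ (SV i))[]] := SP i.
  split; first exact: prod_open.
  split; first exact: continuous_subspaceT.
  have [i|s sP] := @dependent_choice_fun J (fun i => A i -> E i) (fun i s =>
    [/\ {within U i, continuous s}, set_fun (V i) (U i) (p i), set_fun (U i) (V i) s,
      {in V i, cancel (p i) s} & {in U i, cancel s (p i)}]).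
    by have [_ _ /(_ _ (SV i))[_ [_]]] := SP i.
  exists (fun x i => s i (x i)); split.
  + rewrite continuous_open_subspace// => z; rewrite inE => Uz.
    apply: prod_topology_continuous_at => i.
    apply: (@continuous_comp _ _ _ (fun z : prod_topology A => z i) (s i)).
      exact: proj_continuous.
    have [oUi _ _] := UP i; have [cs _ _ _ _] := sP i.
    by move: cs; rewrite continuous_open_subspace//; apply; rewrite inE.
  + by move=> y Vy i; have [_ h _ _ _] := sP i; exact: h.
  + by move=> y Vy i; have [_ _ h _ _] := sP i; exact: h.
  + move=> y; rewrite inE => Vy; apply: functional_extensionality_dep => i.
    by have [_ _ _ h _] := sP i; apply: h; rewrite inE; exact: Vy.
  + move=> y; rewrite inE => Vy; apply: functional_extensionality_dep => i.
    by have [_ _ _ _ h] := sP i; apply: h; rewrite inE; exact: Vy.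
Qed.

Lemma universal_covering_prod (J : finType) (A E : J -> topologicalType)
    (p : forall i, E i -> A i) : (forall i, universal_covering R (p i)) ->
  universal_covering R
    (fun (x : prod_topology E) => (fun i => p i (x i)) : prod_topology A).
Proof.
move=> up; split; first by apply: covering_prod => i; have [] := up i.
by apply: simply_connected_prod => i; have [] := up i.
Qed.

End Products.

(** * Mirrors *)

Section Models.
Variable R : realType.
Local Notation I := (unit_interval R).

(* Simplices and the interval are contractible, so [r] is seen by singular homology
   and by path components as a homeomorphism onto [C]. *)
Definition contractible_model (T : topologicalType) (C : set T) :=
  exists (F : topologicalType) (r : F -> T),
  [/\ contractible R F, continuous r, injective r, forall f, C (r f) &
    forall (Z : topologicalType) (g : Z -> T), contractible R Z ->
      continuous g -> (forall z, C (g z)) ->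
      exists k : Z -> F, continuous k /\ forall z, r (k z) = g z].

Lemma contractible_model_acyclicT (T : topologicalType) :
  contractible_model [set: T] -> acyclic R T.
Proof.
move=> [F [r [ctrF cr injr _ lr]]]; apply: (acyclic_of_simplex_lift ctrF cr injr).
move=> k s; apply: lr => //; first exact: std_simplex_contractible.
exact: cts_fun.
Qed.

Lemma contractible_model_acyclic (T : topologicalType) (C : set T) :
  contractible_model C -> acyclic R C.
Proof.
move=> [F [r [ctrF cr injr Cr lr]]].
pose r' (f : F) : C := exist _ (r f) (mem_set (Cr f)).
apply: (acyclic_of_simplex_lift (r := r') ctrF).
- exact: continuous_comp_initial.
- by move=> a b /(congr1 set_val); exact: injr.
- move=> k s; have cs : continuous (fun t => set_val (s t)).
    by apply: continuous_compose; [exact: cts_fun|exact: initial_continuous].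
  have [z|g [cg gE]] := lr _ _ (std_simplex_contractible R k) cs.
    exact: set_valP.
  by exists g; split=> // t; apply: val_inj; exact: gE.
Qed.

Lemma contractible_modelT (T : topologicalType) :
  contractible R T -> contractible_model [set: T].
Proof.
move=> ctrT; exists T, id; split=> //; first exact: continuous_idfun.
by move=> Z g _ cg _; exists g.
Qed.

Lemma contractible_model_prod (J : eqType) (T : J -> topologicalType)
    (C : forall i, set (T i)) : (forall i, contractible_model (C i)) ->
  contractible_model [set x : prod_topology T | forall i, C i (x i)].
Proof.
move=> /dependent_choice_fun[F /dependent_choice_fun[r rP]].
exists (prod_topology F), (fun x i => r i (x i)); split.
- by apply: contractible_prod => i; have [] := rP i.
- by apply: prod_map_continuous => i; have [] := rP i.
- move=> x y xy; apply: functional_extensionality_dep => i.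
  have [_ _ injr _ _] := rP i; apply: injr.
  exact: (congr1 (fun z : prod_topology T => z i) xy).
- by move=> x i; have [_ _ _ h _] := rP i; exact: h.
- move=> Z g ctrZ cg Cg.
  have [i|k kP] := @dependent_choice_fun J (fun i => Z -> F i)
    (fun i k => continuous k /\ forall z, r i (k z) = g z i).
    have [_ _ _ _ h] := rP i.
    by apply: (h Z (fun z => g z i) ctrZ (proj_compose_continuous cg)) => z; exact: Cg.
  exists (fun z i => k i z); split.
    by apply: prod_topology_continuous => i; have [] := kP i.
  by move=> z; apply: functional_extensionality_dep => i; have [_ ->] := kP i.
Qed.

Lemma contractible_model_image (E X : topologicalType) (s : E -> X) (C : set E) :
  continuous s -> injective s ->
  (forall (Z : topologicalType) (g : Z -> X), contractible R Z -> continuous g ->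
    exists k : Z -> E, continuous k /\ forall z, s (k z) = g z) ->
  contractible_model C -> contractible_model (s @` C).
Proof.
move=> cs injs ls [F [r [ctrF cr injr Cr lr]]].
exists F, (fun f => s (r f)); split=> //.
- exact: continuous_compose cr cs.
- by move=> a b /injs/injr.
- by move=> f; exists (r f).
- move=> Z g ctrZ cg Cg; have [k [ck kE]] := ls _ _ ctrZ cg.
  have [z|k' [ck' k'E]] := lr _ k ctrZ ck.
    by have [x Cx] := Cg z; rewrite -kE => /injs <-.
  by exists k'; split=> // z; rewrite k'E kE.
Qed.

(** The comparison along the identity of [X]. Lifting a path from [e0] to [y] through [s] gives
    surjectivity, which in turn provides the base point in [F] that factoring an arbitrary [g]
    requires. *)
Lemma universal_covering_unique (F E X : topologicalType) (q : F -> X) (p : E -> X) :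
  universal_covering R q -> contractible R F -> universal_covering R p ->
  exists s : F -> E, [/\ continuous s, injective s, forall f, p (s f) = q f,
    forall y, exists f, s f = y &
    forall (Z : topologicalType) (g : Z -> E), contractible R Z -> continuous g ->
      exists k : Z -> F, continuous k /\ forall z, s (k z) = g z].
Proof.
move=> uq ctrF up.
have [[cp _ _] [pcE _]] := up; have [[e0 _] _] := pcE.
have [f0 qf0] : exists f0, q f0 = p e0.
  by have [[_ qT _] _] := uq; have [f0 _ <-] : range q (p e0) by [rewrite qT]; exists f0.
have pi1_id : pi1_injective R (@id X) by [].
have [s [cs injs s0 ps ls]] := universal_covering_comparison uq ctrF up
  (@continuous_idfun X) (fun _ _ => id) pi1_id qf0.
have surj y : exists f, s f = y.
  have [g [cg g0 g1]] := path_connectedP e0 y pcE.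
  have [|||k [_ kE]] := ls _ g (p \o g) zero f0 (unit_interval_contractible R) cg.
  - exact: continuous_compose cg cp.
  - by [].
  - by rewrite s0 g0.
  by exists (k one); rewrite kE.
exists s; split=> // Z g ctrZ cg; have [c _] := ctrZ.
have [f1 sf1] := surj (g c).
by apply: (ls _ g (p \o g) c f1) => //; exact: continuous_compose cg cp.
Qed.

(* Without local connectedness the path component need not be homeomorphic to the
   universal cover of its image, but contractible spaces cannot tell them apart. *)
Lemma contractible_model_path_component (E A : topologicalType) (p : E -> A)
    (B : set A) (e0 : E) : universal_covering R p -> aspherical_pair R B ->
  B (p e0) -> contractible_model (path_component R (p @^-1` B) e0).
Proof.
move=> up [_ aspB] Be0; pose D := path_component R B (p e0).
have [[cp _ _] _] := up.
have [[_ [F [q [uq ctrF]]]] pih] := aspB D (ex_intro2 _ _ (p e0) Be0 erefl).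
have pD (f : I -> E) t : continuous f -> (forall u, B (p (f u))) ->
    f zero = e0 -> D (p (f t)).
  move=> cf fB f0; rewrite /D -f0.
  exact: (path_component_prefix (f := p \o f) t (continuous_compose cf cp)).
have De0 : D (p e0) by exact: path_component_refl.
have [f0 qf0] : exists f0, q f0 = exist _ (p e0) (mem_set De0).
  have [[_ qT _] _] := uq.
  by have [f0 _ <-] : range q (exist _ (p e0) (mem_set De0)) by [rewrite qT]; exists f0.
have [||r [cr injr r0 pr lr]] := universal_covering_comparison uq ctrF up
    (h := set_val) (f0 := f0) (e0 := e0) (@initial_continuous _ _ set_val) _ pih.
- exact: val_inj.
- by rewrite qf0.
have lrD (Z : topologicalType) (g : Z -> E) z0 f1 : contractible R Z ->
    continuous g -> (forall z, D (p (g z))) -> r f1 = g z0 ->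
    exists k : Z -> F, continuous k /\ forall z, r (k z) = g z.
  move=> ctrZ cg Dg rf1.
  apply: (lr _ g (fun z => exist _ (p (g z)) (mem_set (Dg z)) : D) z0 f1) => //.
  by apply: continuous_comp_initial; exact: continuous_compose cg cp.
exists F, r; split=> //.
- move=> f; have [_ [pcF _]] := uq.
  have [g [cg g0 g1]] := path_connectedP f0 f pcF.
  apply/path_componentP; exists (r \o g); split=> /=.
  + exact: continuous_compose cg cr.
  + by rewrite g0.
  + by rewrite g1.
  + move=> t; rewrite pr; have := set_valP (q (g t)); exact: path_component_sub.
- move=> Z g ctrZ cg Cg; have [c _] := ctrZ.
  have Dg z : D (p (g z)).
    by have /path_componentP[f [cf f0' <- fB]] := Cg z; exact: pD.
  (* The image of [g] may miss [e0]. A path from [e0] to [g c] factors through [r] first, and its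
     end is the point of [F] over [g c] needed to factor [g]. *)
  have /path_componentP[f [cf f0' f1 fB]] := Cg c.
  have [t||k [_ kE]] := lrD _ f zero f0 (unit_interval_contractible R) cf.
  + exact: pD.
  + by rewrite r0 f0'.
  by apply: (lrD _ g c (k one)) => //; rewrite kE.
Qed.

End Models.

(** * Mirrors induced on a universal cover of the product *)

Section CornerMirrors.
Variables (R : realType) (J : finType) (A E : J -> topologicalType).
Variables (p : forall i, E i -> A i) (B : forall i, set (A i)).
Variables (Xt : topologicalType) (P : Xt -> prod_topology A) (s : prod_topology E -> Xt).
Hypothesis pcE : forall i, path_connected R (E i).
Hypothesis cs : continuous s.
Hypothesis injs : injective s.
Hypothesis surjs : forall y, exists x, s x = y.
Hypothesis Ps : forall x, P (s x) = (fun i => p (x i)).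
Hypothesis ls : forall (Z : topologicalType) (g : Z -> Xt), contractible R Z ->
  continuous g -> exists k : Z -> prod_topology E, continuous k /\ forall z, s (k z) = g z.
Local Notation I := (unit_interval R).
Local Notation mirror := (@induced_mirror _ _ R Xt P (corner_mirror B)).
Local Notation index := (@induced_index _ _ R Xt P (corner_mirror B)).

(** Paths in [Xt] factor through [s], and lying over the mirror [i] constrains only coordinate [i].
    The other coordinates range over all of the path connected [E j]. *)
Lemma corner_path_component (i : J) (x0 : prod_topology E) :
  path_component R (P @^-1` corner_mirror B i) (s x0) =
  s @` [set x | path_component R (@p i @^-1` @B i) (x0 i) (x i)].
Proof.
apply/seteqP; split=> [y /path_componentP[g [cg g0 g1 gB]]|_ [x + <-]].
  have [k [ck kE]] := ls (unit_interval_contractible R) cg.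
  exists (k one); last by rewrite kE.
  apply/path_componentP; exists (fun t => k t i); split=> //.
  - exact: proj_compose_continuous.
  - by have -> : k zero = x0 by apply: injs; rewrite kE.
  - by move=> t; have := gB t; rewrite /corner_mirror /= -kE Ps.
move=> /path_componentP[g [cg g0 g1 gB]].
have [j|h hP] := @dependent_choice_fun J (fun j => I -> E j) (fun j h =>
    [/\ continuous h, h zero = x0 j, h one = x j & j = i -> forall t, @B j (p (h t))]).
  have [ji|ji] := pselect (j = i); first by rewrite ji; exists g.
  by have [h [ch h0 h1]] := path_connectedP (x0 j) (x j) (pcE j); exists h.
apply/path_componentP; exists (fun t => s (fun j => h j t)); split.
- apply: (continuous_compose _ cs); apply: prod_topology_continuous => j.
  by have [] := hP j.
- by congr s; apply: functional_extensionality_dep => j; have [] := hP j.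
- by congr s; apply: functional_extensionality_dep => j; have [] := hP j.
- by move=> t; rewrite /corner_mirror /= Ps; have [_ _ _ /(_ erefl)] := hP i.
Qed.

Lemma induced_mirror_component (e : index) (y : Xt) : mirror e y ->
  mirror e = path_component R (P @^-1` corner_mirror B (projT1 e)) y.
Proof.
case: e => i C; rewrite /induced_mirror /= set_valE.
have [y0 _ <-] := set_valP C; exact: path_component_eq.
Qed.

Lemma induced_mirror_neq0 (e : index) : exists y, mirror e y.
Proof.
case: e => i C; rewrite /induced_mirror /= set_valE.
by have [y0 By0 <-] := set_valP C; exists y0; exact: path_component_refl.
Qed.

(** Two path components of the same preimage that share a point coincide. *)
Lemma induced_mirror_inj (e e' : index) (y : Xt) :
  mirror e y -> mirror e' y -> projT1 e = projT1 e' -> e = e'.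
Proof.
move=> ey e'y; have := induced_mirror_component ey.
have := induced_mirror_component e'y; move: ey e'y.
case: e e' => i C [j C'] /= _ _ C'E CE ij; subst j.
by congr existT; apply: val_inj; exact: etrans CE (esym C'E).
Qed.

Lemma induced_mirrorE (e : index) (x : prod_topology E) : mirror e (s x) ->
  mirror e = s @` [set z : prod_topology E |
    path_component R (@p (projT1 e) @^-1` @B (projT1 e)) (x (projT1 e)) (z (projT1 e))].
Proof. by move=> /induced_mirror_component ->; exact: corner_path_component. Qed.

Lemma induced_mirror_sub (e : index) (x : prod_topology E) : mirror e (s x) ->
  @B _ (p (x (projT1 e))).
Proof.
move=> ex; have := ex; rewrite (induced_mirror_component ex) => /path_component_sub.
by rewrite /= /corner_mirror /= Ps.
Qed.

(** A nonempty intersection of mirrors is the image under [s] of a box whose factors are path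
    components or whole spaces [E i]. Each factor has a contractible model, and models pass to
    products and to images under [s]. *)
Lemma induced_mirror_acyclic : (forall i, contractible R (E i)) ->
  (forall i, universal_covering R (@p i)) ->
  (forall i, aspherical_pair R (@B i)) -> mirror_acyclic R mirror.
Proof.
move=> ctrE up asp.
have modelE := contractible_model_image cs injs ls.
split.
  apply: contractible_model_acyclicT.
  have := modelE _ (contractible_modelT (contractible_prod ctrE)).
  congr contractible_model; apply/seteqP; split=> // y _.
  by have [x <-] := surjs y; exists x.
move=> K [y Ky]; have [x0 sx0] := surjs y.
have Kx0 e : K e -> mirror e (s x0) by move=> Ke; rewrite sx0; exact: Ky.
(* If no index of [K] lies over [i], the implication is vacuous and [C i] is all of [E i]. Otherwise
   the common point [s x0] fixes the path component. *)
pose C i : set (E i) := [set z | (exists2 e, K e & projT1 e = i) ->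
  path_component R (@p i @^-1` @B i) (x0 i) z].
have -> : mirror_inter mirror K = s @` [set x : prod_topology E | forall i, C i (x i)].
  apply/seteqP; split=> [z Kz|_ [x Cx <-] e Ke].
    have [x sx] := surjs z; exists x => // i [e Ke <-].
    have := Kz e Ke; rewrite (induced_mirrorE (Kx0 e Ke)) -sx => -[x' + /injs x'x].
    by rewrite x'x.
  rewrite (induced_mirrorE (Kx0 e Ke)); exists x => //.
  by apply: Cx; exists e.
apply: contractible_model_acyclic; apply: modelE.
apply: contractible_model_prod => i.
have [[e Ke ei]|nKi] := pselect (exists2 e, K e & projT1 e = i).
  have -> : C i = path_component R (@p i @^-1` @B i) (x0 i).
    by apply/seteqP; split=> z; [apply; exists e|move=> h _].
  apply: contractible_model_path_component => //.
  by rewrite -ei; exact: induced_mirror_sub (Kx0 e Ke).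
have -> : C i = setT by apply/seteqP; split=> // z _ /nKi.
exact: contractible_modelT.
Qed.

(** Mirrors in [K] meet pairwise, so [K] has at most one index over each [i] and is finite because
    [J] is. The mirrors left constrain different coordinates, so a common point can be assembled
    coordinate by coordinate. *)
Lemma induced_mirror_flag : (forall i, @B i !=set0) -> mirror_flag mirror.
Proof.
move=> Bn0 K K0 Kpair.
have Kinj e e' : K e -> K e' -> projT1 e = projT1 e' -> e = e'.
  move=> Ke Ke' ee'; apply: contrapT => ne.
  have [_ _ [y yee']] := Kpair _ _ Ke Ke' ne.
  by apply: ne; apply: (@induced_mirror_inj _ _ y) => //; apply: yee'; [left|right].
have [x0 _] := (path_connected_prod pcE).1.
split=> //.
  rewrite -(eq_finite_set (inj_card_eq (f := @projT1 _ _) _)) ?finite_finset//.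
  by move=> e e' /set_mem Ke /set_mem Ke'; exact: Kinj.
(* Coordinate [i] is taken from some point of the only mirror of [K] over [i], or from [x0] if there
   is none. *)
have [i|x xP] := @dependent_choice_fun J (fun i => E i) (fun i z =>
    forall e, K e -> projT1 e = i -> exists2 x : prod_topology E, x i = z & mirror e (s x)).
  have [[e Ke ei]|nKi] := pselect (exists2 e, K e & projT1 e = i).
    have [y ey] := induced_mirror_neq0 e; have [x sx] := surjs y.
    exists (x i) => e' Ke' e'i; exists x => //.
    by rewrite (Kinj _ _ Ke' Ke) ?sx// e'i.
  by exists (x0 i) => e Ke ei; case: nKi; exists e.
exists (s x) => e Ke; have [x' x'x ex'] := xP _ e Ke erefl.
rewrite (induced_mirrorE ex'); exists x => //=; rewrite x'x.
by apply: path_component_refl; rewrite /= -x'x; exact: induced_mirror_sub.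
Qed.

End CornerMirrors.

Theorem theorem3p17 (R : realType) (n : nat)
    (A : 'I_n.+1 -> topologicalType) (B : forall i, set (A i))
    (asphAB : forall i, aspherical_pair R (B i))
    (B_closed : forall i, closed (B i)) (B_neq0 : forall i, B i !=set0) :
  aspherical R (prod_topology A) /\
  forall (Xt : topologicalType) (p : Xt -> prod_topology A),
    universal_covering R p ->
    mirror_acyclic R (@induced_mirror _ _ R Xt p (corner_mirror B)) /\
    mirror_flag (@induced_mirror _ _ R Xt p (corner_mirror B)).
Proof.
have [E /dependent_choice_fun[q qP]] :=
  dependent_choice_fun (fun i => (asphAB i).1.2).
have uq i := (qP i).1; have ctrE i := (qP i).2.
have uQ := universal_covering_prod uq.
have ctrQ := contractible_prod ctrE.
split.
  split; first by apply: path_connected_prod => i; have [[]] := asphAB i.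
  by exists (prod_topology E), (fun x i => q i (x i)).
move=> Xt p up.
have [s [cs injs ps surjs ls]] := universal_covering_unique uQ ctrQ up.
have pcE i : path_connected R (E i) by have [_ []] := uq i.
split; last exact: (induced_mirror_flag pcE cs injs surjs ps ls).
exact: (induced_mirror_acyclic pcE cs injs surjs ps ls).
Qed.
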